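(* Let $\mathbb{F}$ be an algebraically closed field, let $d \geq 3$ be an integer, and let $\Phi$ be a Leonard system over $\mathbb{F}$ with diameter $d$ and parameter array $(\{\theta_i\}_{i=0}^d, \{\theta^*_i\}_{i=0}^d, \{\varphi_i\}_{i=1}^d, \{\phi_i\}_{i=1}^d)$. Assume $\varphi_1 + \varphi_d \neq \phi_1 + \phi_d$. Let $\Phi'$ be a Leonard system over $\mathbb{F}$ with diameter $d$ that has the same fundamental parameter and the same end-entries as $\Phi$. Then $\Phi'$ is isomorphic to $\Phi$.
   Context: Let $\mathbb{F}$ be an algebraically closed field, $d\ge 0$ an integer, and $V$ a vector space over $\mathbb{F}$ of dimension $d+1$. A square matrix is tridiagonal if every nonzero entry lies on the diagonal, the subdiagonal or the superdiagonal; a tridiagonal matrix is irreducible if all entries on the subdiagonal and on the superdiagonal are nonzero. A Leonard pair on $V$ is an ordered pair of linear maps $A: V\to V$, $A^*: V\to V$ ($A^*$ is just a second map, not an adjoint) such that (i) there is a basis of $V$ with respect to which the matrix of $A$ is irreducible tridiagonal and the matrix of $A^*$ is diagonal; (ii) there is a basis of $V$ with respect to which the matrix of $A^*$ is irreducible tridiagonal and the matrix of $A$ is diagonal. It is known that each of $A, A^*$ then has $d+1$ mutually distinct eigenvalues. The primitive idempotent of $A$ associated with an eigenvalue $\theta$ is the linear map acting as the identity on the $\theta$-eigenspace and as $0$ on the other eigenspaces; similarly for $A^*$. An ordering $\{E_i\}_{i=0}^d$ of the primitive idempotents of $A$ is standard if, for nonzero $v_i\in E_iV$, the basis $\{v_i\}_{i=0}^d$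 satisfies (ii) (i.e. $A^*$ is irreducible tridiagonal with respect to it); an ordering $\{E^*_i\}_{i=0}^d$ of the primitive idempotents of $A^*$ is standard if, for nonzero $v^*_i\in E^*_iV$, the basis $\{v^*_i\}_{i=0}^d$ satisfies (i). A Leonard system on $V$ (over $\mathbb{F}$, with diameter $d$) is a sequence $\Phi=(A,\{E_i\}_{i=0}^d,A^*,\{E^*_i\}_{i=0}^d)$ where $A,A^*$ is a Leonard pair on $V$ and $\{E_i\}_{i=0}^d$, $\{E^*_i\}_{i=0}^d$ are standard orderings of the primitive idempotents of $A$, $A^*$ respectively. An isomorphism from $\Phi$ to a Leonard system $\Phi'=(A',\{E'_i\}_{i=0}^d,A^{*\prime},\{E^{*\prime}_i\}_{i=0}^d)$ on $V'$ is a linear bijection $\sigma:V\to V'$ with $\sigma A=A'\sigma$, $\sigma A^*=A^{*\prime}\sigma$, $\sigma E_i=E'_i\sigma$, $\sigma E^*_i=E^{*\prime}_i\sigma$ for $0\le i\le d$; $\Phi,\Phi'$ are isomorphic if such $\sigma$ exists. The parameter array of $\Phi$ is $(\{\theta_i\}_{i=0}^d,\{\theta^*_i\}_{i=0}^d,\{\varphi_i\}_{i=1}^d,\{\phi_i\}_{i=1}^d)$, where $\theta_i$ (resp. $\theta^*_i$) is the eigenvalue of $A$ (resp. $A^*$) associated with $E_i$ (resp. $E^*_i$), and for $1\le i\le d$ \[ \varphi_i=(\theta^*_0-\theta^*_i)\frac{\mathrm{tr}(E^*_0\prod_{h=0}^{i-1}(A-\theta_hI))}{\mathrm{tr}(E^*_0\prod_{h=0}^{i-2}(A-\theta_hI))},\qquad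 \phi_i=(\theta^*_0-\theta^*_i)\frac{\mathrm{tr}(E^*_0\prod_{h=0}^{i-1}(A-\theta_{d-h}I))}{\mathrm{tr}(E^*_0\prod_{h=0}^{i-2}(A-\theta_{d-h}I))}, \] with empty products equal to the identity $I$ (the denominators are known to be nonzero). For $d\ge 3$ it is known that the expressions $\frac{\theta_{i-2}-\theta_{i+1}}{\theta_{i-1}-\theta_i}$ and $\frac{\theta^*_{i-2}-\theta^*_{i+1}}{\theta^*_{i-1}-\theta^*_i}$ are equal and independent of $i$ for $2\le i\le d-1$; the fundamental parameter $\beta$ of $\Phi$ is one less than this common value. The principal sequence of $\Phi$ is $\{a_i\}_{i=0}^d$ with $a_i=\mathrm{tr}(AE^*_i)$, and the dual principal sequence is $\{a^*_i\}_{i=0}^d$ with $a^*_i=\mathrm{tr}(A^*E_i)$. The end-entries of $\Phi$ are $\theta_0,\theta_d,\theta^*_0,\theta^*_d,a_0,a_d,a^*_0,a^*_d$; two Leonard systems of diameter $d$ have the same end-entries if these eight scalars coincide respectively. *)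

(* Defs.v *)
From HB Require Import structures.
From mathcomp Require Import all_boot all_order all_algebra.

Set Implicit Arguments.
Unset Strict Implicit.
Unset Printing Implicit Defensive.

Import GRing.Theory passmx.
Local Open Scope ring_scope.

Section Matrices.
Variables (F : fieldType) (n : nat).
Implicit Type B : 'M[F]_n.

Definition tridiagonal B : Prop :=
  forall i j : 'I_n, B i j != 0 -> [|| i == j, i == j.+1 :> nat | j == i.+1 :> nat].

Definition irreducible_tridiagonal B : Prop :=
  tridiagonal B /\
  (forall i j : 'I_n, (i == j.+1 :> nat) || (j == i.+1 :> nat) -> B i j != 0).

End Matrices.

Section Endomorphisms.
Variables (F : fieldType) (V : vectType F).
Implicit Types A As E : 'End(V).

(* Column convention: f (v`_j) = \sum_i lfun_mx v f i j *: v`_i when v is a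
   basis. When n is \dim {:V}, this is the transpose of mxof v v f; here n is
   left free so that bases can have a size which is only propositionally equal
   to \dim {:V}. *)
Definition lfun_mx n (v : n.-tuple V) (f : 'End(V)) : 'M[F]_n :=
  \matrix_(i, j) coord v i (f v`_j).

Definition lfun_trace (f : 'End(V)) : F :=
  \tr (mxof (vbasis {:V}) (vbasis {:V}) f).

(* With respect to v, the first map is irreducible tridiagonal and the second
   one is diagonal. *)
Definition tridiagonal_diagonal_basis n (v : n.-tuple V) (f g : 'End(V)) : Prop :=
  [/\ basis_of {:V} v,
      irreducible_tridiagonal (lfun_mx v f)
    & is_diag_mx (lfun_mx v g)].

Definition leonard_pair A As : Prop :=
  (exists v : (\dim {:V}).-tuple V, tridiagonal_diagonal_basis v A As) /\
  (exists v : (\dim {:V}).-tuple V, tridiagonal_diagonal_basis v As A).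

Definition primitive_idempotent A (th : F) E : Prop :=
  [/\ leigenvalue A th,
      forall v, v \in leigenspace A th -> E v = v
    & forall th', leigenvalue A th' -> th' != th ->
        forall v, v \in leigenspace A th' -> E v = 0].

Definition idempotent_ordering n A (E : 'I_n -> 'End(V)) : Prop :=
  injective E /\
  (forall P : 'End(V),
     (exists th, primitive_idempotent A th P) <-> (exists i, E i = P)).

(* Standard orderings of the primitive idempotents of A, for the pair A, As;
   for those of As, exchange A and As. *)
Definition standard_ordering n A As (E : 'I_n -> 'End(V)) : Prop :=
  idempotent_ordering A E /\
  (forall v : n.-tuple V,
     (forall i : 'I_n, v`_i != 0 /\ v`_i \in limg (E i)) ->
     tridiagonal_diagonal_basis v As A).

End Endomorphisms.

Record leonard_system (F : fieldType) (d : nat) (V : vectType F) :=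
  LeonardSystem {
    ls_A : 'End(V);
    ls_E : 'I_d.+1 -> 'End(V);
    ls_As : 'End(V);
    ls_Es : 'I_d.+1 -> 'End(V);
    ls_dim : \dim {:V} = d.+1;
    ls_pair : leonard_pair ls_A ls_As;
    ls_standardE : standard_ordering ls_A ls_As ls_E;
    ls_standardEs : standard_ordering ls_As ls_A ls_Es
  }.

Definition isomorphic (F : fieldType) (d : nat) (V V' : vectType F)
    (Phi : leonard_system d V) (Phi' : leonard_system d V') : Prop :=
  exists sigma : 'Hom(V, V'),
    [/\ bijective sigma,
        (sigma \o ls_A Phi = ls_A Phi' \o sigma)%VF,
        (sigma \o ls_As Phi = ls_As Phi' \o sigma)%VF
      & forall i : 'I_d.+1,
          (sigma \o ls_E Phi i = ls_E Phi' i \o sigma)%VF /\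
          (sigma \o ls_Es Phi i = ls_Es Phi' i \o sigma)%VF].

Section SystemScalars.
Variables (F : fieldType) (d : nat) (V : vectType F).
Variable Phi : leonard_system d V.
Implicit Types theta thetas : 'I_d.+1 -> F.

Definition eigenvalue_sequence theta : Prop :=
  forall i, primitive_idempotent (ls_A Phi) (theta i) (ls_E Phi i).

Definition dual_eigenvalue_sequence thetas : Prop :=
  forall i, primitive_idempotent (ls_As Phi) (thetas i) (ls_Es Phi i).

(* tr(Es_0 \prod_(h < k) (A - theta_h I)) *)
Definition split_trace theta (k : nat) : F :=
  lfun_trace
    (ls_Es Phi ord0 \o
     \big[(@comp_lfun F V V V) / \1]_(h < d.+1 | (h < k)%N)
        (ls_A Phi - theta h *: \1))%VF.

Definition split_value theta thetas (i : nat) : F :=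
  (thetas ord0 - thetas (inord i)) * (split_trace theta i / split_trace theta i.-1).

(* The split sequences are indexed from 1 to d; their values elsewhere are
   irrelevant. Note that rev_ord h is d - h. *)
Definition parameter_array theta thetas (varphi phi : nat -> F) : Prop :=
  [/\ eigenvalue_sequence theta,
      dual_eigenvalue_sequence thetas,
      forall i, (1 <= i <= d)%N -> varphi i = split_value theta thetas i
    & forall i, (1 <= i <= d)%N ->
        phi i = split_value (fun h => theta (rev_ord h)) thetas i].

Definition eigenvalue_ratio theta (i : nat) : F :=
  (theta (inord (i - 2)) - theta (inord i.+1)) /
  (theta (inord i.-1) - theta (inord i)).

(* Meaningful for d >= 3 only. *)
Definition fundamental_parameter (beta : F) : Prop :=
  exists theta thetas,
    [/\ eigenvalue_sequence theta,
        dual_eigenvalue_sequence thetas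
      & forall i, (2 <= i <= d.-1)%N ->
          beta = eigenvalue_ratio theta i - 1 /\
          beta = eigenvalue_ratio thetas i - 1].

Definition principal_sequence (i : 'I_d.+1) : F :=
  lfun_trace (ls_A Phi \o ls_Es Phi i)%VF.

Definition dual_principal_sequence (i : 'I_d.+1) : F :=
  lfun_trace (ls_As Phi \o ls_E Phi i)%VF.

Definition end_entries (e : seq F) : Prop :=
  exists theta thetas,
    [/\ eigenvalue_sequence theta,
        dual_eigenvalue_sequence thetas
      & e = [:: theta ord0; theta ord_max; thetas ord0; thetas ord_max;
                principal_sequence ord0; principal_sequence ord_max;
                dual_principal_sequence ord0; dual_principal_sequence ord_max]].

End SystemScalars.

Definition same_fundamental_parameter (F : fieldType) (d : nat)
    (V V' : vectType F) (Phi : leonard_system d V) (Phi' : leonard_system d V') :=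
  exists beta : F, fundamental_parameter Phi beta /\ fundamental_parameter Phi' beta.

Definition same_end_entries (F : fieldType) (d : nat)
    (V V' : vectType F) (Phi : leonard_system d V) (Phi' : leonard_system d V') :=
  exists e : seq F, end_entries Phi e /\ end_entries Phi' e.

(* Main.v *)
Require Import Defs.
From HB Require Import structures.
From mathcomp Require Import all_boot all_order all_algebra.
From mathcomp Require Import ring zify.

Set Implicit Arguments.
Unset Strict Implicit.
Unset Printing Implicit Defensive.

Import GRing.Theory passmx.
Local Open Scope ring_scope.

(* Let v span E*_0 V and u_k = (A - theta_0) ... (A - theta_(k-1)) v. Then
   (A* - theta*_k) u_k = varphi_k u_(k-1) with varphi_k <> 0, and comparing
   coordinates gives
     varphi_1 = (a_0 - theta_0)(theta*_0 - theta*_1)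
              = (a*_0 - theta*_0)(theta_0 - theta_1),
     varphi_d = (a*_d - theta*_d)(theta_d - theta_(d-1));
   reversing the E_i yields the analogues for phi_1 and phi_d, so that
     varphi_1 + varphi_d - phi_1 - phi_d
       = (theta*_0 - theta*_d)(theta_d - theta_(d-1) - theta_0 + theta_1).
   The gap theta_0 - theta_1 - (theta_d - theta_(d-1)) depends only on beta and
   the end-entries; when it is nonzero, the relations above determine theta_1,
   theta_(d-1), theta*_1, theta*_(d-1), hence by the recurrence all eigenvalues,
   and also varphi_1 and varphi_d.
   Finally let s map u'_k to u_k. It intertwines A' and A, and
   D = A* s - s A*' kills u'_0, u'_1 and u'_d. The tridiagonal-relation
   expression
     Y = A^2 D - beta A D A' + D A'^2 - gamma (A D + D A') - rho D
   is diagonal in the eigenbases of A' and A, Y u'_0 is a multiple of u_1 and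
   Y u'_d = 0. This forces Y = 0, and then D u'_k = 0 for all k. *)

(** * Sequences satisfying the eigenvalue recurrence *)

Section Recurrence.
Variables (F : fieldType) (d : nat) (b : F).
Implicit Types th : nat -> F.

Definition recurrent th : Prop := forall i, (i.+3 <= d)%N ->
  th i - th i.+3 = (b + 1) * (th i.+1 - th i.+2).

(** The scalar gamma of the tridiagonal relation. *)
Definition rec_const th : F := th 0%N - b * th 1%N + th 2%N.

Lemma recurrentP th : recurrent th ->
  forall i, (i.+2 <= d)%N -> th i - b * th i.+1 + th i.+2 = rec_const th.
Proof.
move=> rth; elim=> // i IH hi; rewrite -IH; last exact: ltnW.
have := rth i hi; move=> /eqP; rewrite subr_eq => /eqP ->; ring.
Qed.

(** Consecutive instances differ by [th i.+2 - th i] times the relation of [recurrentP]. The common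
    value is the scalar rho of the tridiagonal relation. *)
Lemma recurrent_quadratic th : recurrent th -> forall i, (i < d)%N ->
  th i ^+ 2 - b * th i * th i.+1 + th i.+1 ^+ 2
    - rec_const th * (th i + th i.+1)
  = th 0%N ^+ 2 - b * th 0%N * th 1%N + th 1%N ^+ 2
    - rec_const th * (th 0%N + th 1%N).
Proof.
move=> rth; elim=> // i IH hi; rewrite -IH; last exact: ltnW.
rewrite -(recurrentP rth hi); ring.
Qed.

(** A discrete Wronskian: the shift from [(s i, s i.+1)] to [(s i.+1, s i.+2)] has determinant 1. *)
Lemma casoratian_const (s t : nat -> F) (n : nat) :
  (forall i, (i.+2 <= n)%N -> s i - b * s i.+1 + s i.+2 = 0) ->
  (forall i, (i.+2 <= n)%N -> t i - b * t i.+1 + t i.+2 = 0) ->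
  forall i, (i < n)%N ->
    s i * t i.+1 - s i.+1 * t i = s 0%N * t 1%N - s 1%N * t 0%N.
Proof.
move=> hs ht; elim=> // i IH hi; rewrite -IH; last exact: ltnW.
have Es : s i.+2 = b * s i.+1 - s i.
  by apply/eqP; rewrite -subr_eq0 -(hs i hi); apply/eqP; ring.
have Et : t i.+2 = b * t i.+1 - t i.
  by apply/eqP; rewrite -subr_eq0 -(ht i hi); apply/eqP; ring.
rewrite Es Et; ring.
Qed.

(* The antisymmetric parts [th i - th (d - i)] satisfy a second order
   recurrence, so the Casoratian of two of them is constant; it vanishes in the
   middle. *)
Lemma recurrent_antisymmetric th ths : (0 < d)%N ->
    recurrent th -> recurrent ths ->
  (th 0%N - th d) * (ths 1%N - ths d.-1) = (th 1%N - th d.-1) * (ths 0%N - ths d).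
Proof.
move=> d0 rth rths.
pose s i := th i - th (d - i)%N; pose t i := ths i - ths (d - i)%N.
have anti (g : nat -> F) : recurrent g -> forall i, (i.+2 <= d)%N ->
    (g i - g (d - i)%N) - b * (g i.+1 - g (d - i.+1)%N)
      + (g i.+2 - g (d - i.+2)%N) = 0.
  move=> rg i hi.
  have h2 : ((d - i.+2).+2 <= d)%N by lia.
  have := recurrentP rg h2.
  have -> : (d - i.+2).+2 = (d - i)%N by lia.
  have -> : (d - i.+2).+1 = (d - i.+1)%N by lia.
  rewrite -(recurrentP rg hi) => E.
  by apply/eqP; rewrite -(subrr (g i - b * g i.+1 + g i.+2)) -{2}E; apply/eqP; ring.
have C := casoratian_const (s := s) (t := t) (anti _ rth) (anti _ rths).
have hm : (d./2 < d)%N by lia.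
have := C _ hm; rewrite /s /t subn0 subn1 => H.
apply/eqP; rewrite -subr_eq0 -H; apply/eqP.
(* With m = [d./2], odd [d] gives s(m+1) = - s(m) and t(m+1) = - t(m), while even [d] gives s(m) =
   t(m) = 0. *)
have [od|ed] := boolP (odd d).
  have -> : (d - d./2)%N = d./2.+1 by lia.
  have -> : (d - d./2.+1)%N = d./2 by lia.
  ring.
have -> : (d - d./2)%N = d./2 by lia.
ring.
Qed.

(** The difference [D] solves a second-order recurrence with constant right side [c] and vanishes at
    two indices at each end. If [c] is 0, it vanishes identically; otherwise two invariants force
    characteristic 2, and then the gap hypothesis fails. *)
Lemma recurrent_unique th th' : (3 <= d)%N -> recurrent th -> recurrent th' ->
    th 0%N = th' 0%N -> th 1%N = th' 1%N -> th d.-1 = th' d.-1 -> th d = th' d ->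
    th 1%N != th d -> th 0%N - th 1%N != th d - th d.-1 ->
  forall i, (i <= d)%N -> th i = th' i.
Proof.
move=> d3 rth rth' e0 e1 ed1 ed N1 NK.
have [n En] : exists n, d = n.+2 by exists d.-2; lia.
rewrite En /= in ed1 ed N1 NK.
pose D i := th i - th' i.
pose c := rec_const th - rec_const th'.
have hD i : (i.+2 <= d)%N -> D i - b * D i.+1 + D i.+2 = c.
  move=> hi; rewrite /c -(recurrentP rth hi) -(recurrentP rth' hi) /D; ring.
have [D0 D1 Dn1 Dn2] : [/\ D 0%N = 0, D 1%N = 0, D n.+1 = 0 & D n.+2 = 0].
  by split; rewrite /D ?e0 ?e1 ?ed1 ?ed subrr.
have D2 : D 2%N = c by rewrite -(hD 0%N) ?D0 ?D1; [ring | lia].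
have Dn : D n = c by rewrite -(hD n) ?Dn1 ?Dn2; [ring | lia].
have hD2 i : (i.+2 <= d)%N -> D i.+2 = c + b * D i.+1 - D i.
  by move=> hi; rewrite -(hD i hi); ring.
have [c0|c0] := eqVneq c 0.
  suff Z i : (i.+1 <= d)%N -> D i = 0 /\ D i.+1 = 0.
    case=> [//|i] hi; apply/eqP; rewrite -subr_eq0; apply/eqP.
    by case: (Z i hi).
  elim: i => // i IH hi; have [Zi Zi1] := IH (ltnW hi).
  by split=> //; rewrite hD2 // Zi Zi1 c0; ring.
exfalso.
(* Casoratian of the increments of [th] and of [D]: those of [D] are 0, [c] at the start and [- c],
   0 at the end. *)
have S : th 1%N - th 0%N = th n.+2 - th n.+1.
  have hth2 i : (i.+2 <= d)%N ->
      th i.+2 = rec_const th + b * th i.+1 - th i.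
    by move=> hi; rewrite -(recurrentP rth hi); ring.
  pose p i := th i.+1 - th i; pose h i := D i.+1 - D i.
  have hp i : (i.+2 <= n.+1)%N -> p i - b * p i.+1 + p i.+2 = 0.
    move=> hi; rewrite /p (hth2 i.+1) ?(hth2 i); [ring | lia | lia].
  have hh i : (i.+2 <= n.+1)%N -> h i - b * h i.+1 + h i.+2 = 0.
    move=> hi; rewrite /h (hD2 i.+1) ?(hD2 i); [ring | lia | lia].
  have := casoratian_const hp hh (ltnSn n).
  rewrite /p /h D0 D1 D2 Dn1 Dn2 Dn => E.
  apply: (mulfI c0); apply/eqP; rewrite -subr_eq0; apply/eqP.
  by move/eqP: E; rewrite eq_sym -subr_eq0 => /eqP <-; ring.
(* At both ends the invariants of [th] and [th'] have the same quadratic part; subtracting leaves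
   the linear parts, whose coefficients differ by [c]. *)
have T : th 0%N + th 1%N = th n.+1 + th n.+2.
  have hn : (n.+1 < d)%N by rewrite En.
  have := recurrent_quadratic rth' hn; have := recurrent_quadratic rth hn.
  rewrite -e0 -e1 -ed -ed1 => /eqP; rewrite -subr_eq0 => /eqP Q.
  move=> /eqP; rewrite -subr_eq0 => /eqP Q'.
  apply: (mulfI c0); apply/eqP; rewrite -subr_eq0; apply/eqP.
  by rewrite -(subr0 0) -{1}Q -Q' /c; ring.
(* Adding [S] and [T] gives 2 = 0. Signs then become immaterial, and [S] contradicts [NK]. *)
have : (1 + 1) * (th 1%N - th n.+2) = 0.
  transitivity (th 1%N - th 0%N - (th n.+2 - th n.+1)
                + (th 0%N + th 1%N - (th n.+1 + th n.+2))); first by ring.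
  by rewrite S T; ring.
move/eqP; rewrite mulf_eq0 subr_eq0 (negPf N1) orbF => /eqP two0.
move/eqP: NK; apply; transitivity ((1 + 1) * (th 0%N - th 1%N) + (th 1%N - th 0%N)).
  ring.
by rewrite two0 S; ring.
Qed.
End Recurrence.

(** * Eigenbases on which the other map is tridiagonal *)

(* The family [x] consists of the coordinates in the basis [e]. *)
Record tridiagonal_eigenbasis (F : fieldType) (V : vectType F) (d : nat)
    (A As : 'End(V)) (th : nat -> F)
    (x : 'I_d.+1 -> {scalar V}) (e : 'I_d.+1 -> V) : Prop := {
  eigenbasis_delta : forall i j, x i (e j) = (i == j)%:R;
  eigenbasis_expand : forall v, v = \sum_i x i v *: e i;
  eigenbasis_eigen : forall i, A (e i) = th i *: e i;
  eigenbasis_inj : forall i j : 'I_d.+1, th i = th j -> i = j;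
  eigenbasis_irr : irreducible_tridiagonal (\matrix_(i, j) x i (As (e j)))
}.

Section Eigenbasis.
Variables (F : fieldType) (V : vectType F) (d : nat) (A As : 'End(V)).
Variables (th : nat -> F) (x : 'I_d.+1 -> {scalar V}) (e : 'I_d.+1 -> V).
Hypothesis Hx : tridiagonal_eigenbasis A As th x e.

Lemma coord_eq0 v : (forall i, x i v = 0) -> v = 0.
Proof.
by move=> x0; rewrite (eigenbasis_expand Hx v) big1 // => i _; rewrite x0 scale0r.
Qed.

Lemma coord_inj v w : (forall i, x i v = x i w) -> v = w.
Proof.
move=> xvw; apply/eqP; rewrite -subr_eq0; apply/eqP/coord_eq0 => i.
by rewrite linearB /= xvw subrr.
Qed.

Lemma coord_eigen i v : x i (A v) = th i * x i v.
Proof.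
rewrite {1}(eigenbasis_expand Hx v) !linear_sum (bigD1 i) //= !linearZ /=.
rewrite (eigenbasis_eigen Hx) linearZ /= (eigenbasis_delta Hx) eqxx mulr1 big1.
  by rewrite addr0 mulrC.
move=> j ji; rewrite !linearZ /= (eigenbasis_eigen Hx) linearZ /=.
by rewrite (eigenbasis_delta Hx) eq_sym (negPf ji) !mulr0.
Qed.

Lemma coord_tridiagonal i v : x i (As v) = \sum_j x i (As (e j)) * x j v.
Proof.
rewrite {1}(eigenbasis_expand Hx v) !linear_sum; apply: eq_bigr => j _.
by rewrite !linearZ /= mulrC.
Qed.

Lemma eigenbasis_far (i j : 'I_d.+1) :
  (i.+1 < j)%N || (j.+1 < i)%N -> x i (As (e j)) = 0.
Proof.
move=> H; apply/eqP; apply: contraTT H => H.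
have [tri _] := eigenbasis_irr Hx.
have := tri i j; rewrite mxE H => /(_ isT); rewrite -(inj_eq val_inj) /=.
lia.
Qed.

Lemma eigenbasis_near (i j : 'I_d.+1) :
  (i == j.+1 :> nat) || (j == i.+1 :> nat) -> x i (As (e j)) != 0.
Proof. by move=> H; have [_ /(_ i j H)] := eigenbasis_irr Hx; rewrite mxE. Qed.

(** A tridiagonal map spreads the support by at most one index. The next lemmas compute the single
    term that survives just outside the support, and do the same from the other side. *)
Lemma coord_raise_eq0 (m : nat) v (i : 'I_d.+1) :
  (forall j : 'I_d.+1, (j < m)%N -> x j v = 0) -> (i.+1 < m)%N -> x i (As v) = 0.
Proof.
move=> v0 im; rewrite coord_tridiagonal big1 // => j _.
have [jm|mj] := ltnP j m; first by rewrite v0 ?mulr0.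
by rewrite eigenbasis_far ?mul0r //; lia.
Qed.

Lemma coord_raise (i j : 'I_d.+1) v : j = i.+1 :> nat ->
  (forall k : 'I_d.+1, (k < j)%N -> x k v = 0) ->
  x i (As v) = x i (As (e j)) * x j v.
Proof.
move=> ji v0; rewrite coord_tridiagonal (bigD1 j) //= big1 ?addr0 // => k kj.
have [kj_|jk] := ltnP k j; first by rewrite v0 ?mulr0.
have kj' : (k != j :> nat) by [].
by rewrite eigenbasis_far ?mul0r //; lia.
Qed.

Lemma coord_lower_eq0 (m : nat) v (i : 'I_d.+1) :
  (forall j : 'I_d.+1, (m < j)%N -> x j v = 0) -> (m.+1 < i)%N -> x i (As v) = 0.
Proof.
move=> v0 im; rewrite coord_tridiagonal big1 // => j _.
have [jm|mj] := ltnP m j; first by rewrite v0 ?mulr0.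
by rewrite eigenbasis_far ?mul0r //; lia.
Qed.

Lemma coord_lower (i j : 'I_d.+1) v : i = j.+1 :> nat ->
  (forall k : 'I_d.+1, (j < k)%N -> x k v = 0) ->
  x i (As v) = x i (As (e j)) * x j v.
Proof.
move=> ji v0; rewrite coord_tridiagonal (bigD1 j) //= big1 ?addr0 // => k kj.
have [kj_|jk] := ltnP j k; first by rewrite v0 ?mulr0.
have kj' : (k != j :> nat) by [].
by rewrite eigenbasis_far ?mul0r //; lia.
Qed.

Lemma eigenbasis_th_neq (i j : nat) : (i <= d)%N -> (j <= d)%N -> i != j ->
  th i != th j.
Proof.
move=> id jd ij; apply: contraNneq ij => E.
have := @eigenbasis_inj _ _ _ _ _ _ _ _ Hx (inord i) (inord j).
by rewrite !inordK // => /(_ E) /(congr1 val) /=; rewrite !inordK // => ->.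
Qed.

End Eigenbasis.

(** Reversing the order of the eigenvectors of [A] turns every statement on varphi into one on
    phi. *)
Lemma eigenbasis_rev (F : fieldType) (V : vectType F) (d : nat)
    (A As : 'End(V)) (th : nat -> F) (x : 'I_d.+1 -> {scalar V}) e :
  tridiagonal_eigenbasis A As th x e ->
  tridiagonal_eigenbasis A As (fun i => th (d - i)%N)
    (fun i => x (rev_ord i)) (fun i => e (rev_ord i)).
Proof.
move=> Hx; have revE (i : 'I_d.+1) : (d - i)%N = rev_ord i by rewrite /= subSS.
split=> [i j|v|i|i j|].
- by rewrite (eigenbasis_delta Hx) (inj_eq rev_ord_inj).
- rewrite {1}(eigenbasis_expand Hx v) (reindex_inj rev_ord_inj) /=.
  by apply: eq_bigr.
- by rewrite (eigenbasis_eigen Hx) revE.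
- by rewrite !revE => /(eigenbasis_inj Hx)/rev_ord_inj.
have [tri irr] := eigenbasis_irr Hx; split=> i j.
- move=> H; have := tri (rev_ord i) (rev_ord j).
  rewrite !mxE in H *; move=> /(_ H); rewrite (inj_eq rev_ord_inj) /=.
  have := ltn_ord i; have := ltn_ord j; case: eqP => //= _ ? ?.
  by case/orP => /eqP ?; apply/orP; [right | left]; apply/eqP; lia.
- move=> H; have := irr (rev_ord i) (rev_ord j); rewrite !mxE; apply.
  have := ltn_ord i; have := ltn_ord j => ? ? /=.
  by case/orP: H => /eqP ?; apply/orP; [right | left]; apply/eqP; lia.
Qed.

(* Locked, so that rewriting with linearity does not unfold it. *)
HB.lock Definition split_vec (F : fieldType) (V : vectType F) (A : 'End(V))
    (th : nat -> F) (v : V) : nat -> V :=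
  fix loop k := if k is k'.+1 then A (loop k') - th k' *: loop k' else v.

Section SplitVec.
Variables (F : fieldType) (V : vectType F) (A : 'End(V)) (th : nat -> F) (v : V).

Lemma split_vec0 : split_vec A th v 0 = v.
Proof. by rewrite unlock. Qed.

Lemma split_vecS k :
  split_vec A th v k.+1 = A (split_vec A th v k) - th k *: split_vec A th v k.
Proof. by rewrite unlock. Qed.

End SplitVec.

(** * Split vectors *)

Section CoordSplit.
Variables (F : fieldType) (V : vectType F) (d : nat) (A As : 'End(V)).
Variables (th : nat -> F) (x : 'I_d.+1 -> {scalar V}) (e : 'I_d.+1 -> V).
Hypothesis Hx : tridiagonal_eigenbasis A As th x e.

(** The split vector is a polynomial in [A] applied to [v], and [A] is diagonal in these
    coordinates. *)
Lemma coord_split_vec v i k :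
  x i (split_vec A th v k) = \prod_(h < k) (th i - th h) * x i v.
Proof.
elim: k => [|k IH]; first by rewrite split_vec0 big_ord0 mul1r.
rewrite split_vecS linearB linearZ /= (coord_eigen Hx) IH big_ord_recr /=; ring.
Qed.

Lemma split_coord_lt v k (i : 'I_d.+1) :
  (i < k)%N -> x i (split_vec A th v k) = 0.
Proof.
by move=> ik; rewrite coord_split_vec (bigD1 (Ordinal ik)) //= subrr !mul0r.
Qed.

End CoordSplit.

Section Split.
Variables (F : fieldType) (V : vectType F) (d : nat) (A As : 'End(V)).
Variables (th ths : nat -> F).
Variables (x y : 'I_d.+1 -> {scalar V}) (e f : 'I_d.+1 -> V).
Hypothesis Hx : tridiagonal_eigenbasis A As th x e.
Hypothesis Hy : tridiagonal_eigenbasis As A ths y f.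
Let u := split_vec A th (f ord0).

(** Each application of [A] extends the support in [f] by at most one index. With [split_dual_diag],
    the passage from [f] to [u] is triangular with nonzero diagonal, so the [u k] span the space. *)
Lemma split_dual_gt k (j : 'I_d.+1) : (k < j)%N -> y j (u k) = 0.
Proof.
elim: k j => [|k IH] j kj.
  by rewrite /u split_vec0 (eigenbasis_delta Hy); case: eqP kj => [->|].
rewrite /u split_vecS linearB linearZ /= IH ?mulr0 ?subr0; last by lia.
exact: (coord_lower_eq0 Hy (m := k)).
Qed.

Lemma split_dual_diag (k : 'I_d.+1) : y k (u k) != 0.
Proof.
case: k => k; elim: k => [|k IH] hk.
  have -> : Ordinal hk = ord0 by apply: val_inj.
  by rewrite /u split_vec0 (eigenbasis_delta Hy) eqxx oner_neq0.
rewrite /u split_vecS linearB linearZ /= (split_dual_gt (k := k)) // mulr0 subr0.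
rewrite (coord_lower Hy (j := Ordinal (ltnW hk))) //; last first.
  by move=> j; apply: split_dual_gt.
by rewrite mulf_neq0 // (eigenbasis_near Hy) //= eqxx.
Qed.

Lemma split_vec_full (W : {vspace V}) :
  (forall k, (k <= d)%N -> u k \in W) -> forall v, v \in W.
Proof.
move=> uW; suff fW i : f i \in W.
  move=> v; rewrite (eigenbasis_expand Hy v).
  by apply: rpred_sum => i _; apply: rpredZ.
case: i => k; elim/ltn_ind: k => k IH hk.
set i := Ordinal hk.
have := eigenbasis_expand Hy (u i).
rewrite (bigD1 i) //= => /eqP; rewrite -subr_eq => /eqP E.
have : y i (u i) *: f i \in W.
  rewrite -E rpredB ?uW //; apply: rpred_sum => j ji.
  have [jlt|jgt] := ltnP j i.
    have -> : j = Ordinal (ltn_ord j) by apply: val_inj.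
    exact: memvZ (IH _ jlt _).
  have ji' : (j != i :> nat) by [].
  by rewrite split_dual_gt ?scale0r ?rpred0 //=; move: jgt ji' => /=; lia.
by rewrite rpredZeq (negPf (split_dual_diag i)).
Qed.

(** If this coordinate vanished, so would the i-th coordinate of every [u k], hence of every vector,
    including [e i]. *)
Lemma coord_start_neq0 i : x i (f ord0) != 0.
Proof.
apply/eqP => x0.
pose g : 'Hom(V, F^o) := linfun (x i : V -> F^o).
have : e i \in lker g.
  apply: split_vec_full => k _.
  by rewrite memv_ker lfunE /= (coord_split_vec Hx) x0 mulr0.
by rewrite memv_ker lfunE /= (eigenbasis_delta Hx) eqxx oner_eq0.
Qed.

Lemma split_coord_diag (k : 'I_d.+1) : x k (u k) != 0.
Proof.
rewrite (coord_split_vec Hx) mulf_neq0 ?coord_start_neq0 //.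
apply/prodf_neq0 => h _; rewrite subr_eq0 (eigenbasis_th_neq Hx) //.
- by have := ltn_ord k; rewrite ltnS.
- by have := ltn_ord k; have := ltn_ord h; lia.
- by have := ltn_ord h; lia.
Qed.

(** The span of the first [k] vectors of [f] meets the span of the [e j] with [j >= k] trivially.
    Subtracting a multiple of [u k] reduces to smaller [k], and the k-th coordinate in [x] kills
    that multiple. *)
Lemma split_vec_eq0 k w : (k <= d.+1)%N ->
  (forall j : 'I_d.+1, (k <= j)%N -> y j w = 0) ->
  (forall j : 'I_d.+1, (j < k)%N -> x j w = 0) -> w = 0.
Proof.
elim: k w => [|k IH] w hk yw xw; first by apply: (coord_eq0 Hy) => j; apply: yw.
pose i := Ordinal hk; pose c := y i w / y i (u i).
have E : w = c *: u k.
  apply/eqP; rewrite -subr_eq0; apply/eqP/IH; first exact: ltnW.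
    move=> j; rewrite leq_eqVlt => /orP[/eqP kj|kj].
      have -> : j = i by apply: val_inj.
      by rewrite linearB linearZ /= divfK ?split_dual_diag ?subrr.
    by rewrite linearB linearZ /= yw // split_dual_gt // mulr0 subr0.
  move=> j jk; rewrite linearB linearZ /= xw ?(split_coord_lt Hx) ?mulr0 ?subr0 //.
  exact: ltnW.
have := xw i (ltnSn k); rewrite E linearZ /= => /eqP.
by rewrite mulf_eq0 (negPf (split_coord_diag i)) orbF => /eqP ->; rewrite scale0r.
Qed.

(** This is varphi_(k+1): the index is shifted to start at 0. Coordinate [k] is used because it
    vanishes on [u k.+1] but not on [u k]. *)
Definition split_coef (k : nat) : F :=
  x (inord k) (As (u k.+1)) / x (inord k) (u k).

Lemma split_vec_dual0 : As (u 0%N) = ths 0%N *: u 0%N.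
Proof. by rewrite /u split_vec0 (eigenbasis_eigen Hy). Qed.

(** The difference of the two sides has no [y] coordinate from [k.+1] on and no [x] coordinate up to
    [k], so [split_vec_eq0] applies. *)
Lemma split_vec_dual k : (k < d)%N ->
  As (u k.+1) = ths k.+1 *: u k.+1 + split_coef k *: u k.
Proof.
move=> kd; have kd1 := ltnW (kd : (k.+1 < d.+1)%N).
have ik : (inord k : 'I_d.+1) = k :> nat by rewrite inordK.
apply/eqP; rewrite -subr_eq0; apply/eqP.
apply: (split_vec_eq0 (k := k.+1)) => //.
  move=> j kj; rewrite linearB linearD !linearZ /= (coord_eigen Hy).
  rewrite (split_dual_gt (k := k)) // mulr0 addr0 -mulrBl.
  move: kj; rewrite leq_eqVlt => /orP[/eqP ->|kj]; first by rewrite subrr mul0r.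
  by rewrite (split_dual_gt (k := k.+1)) ?mulr0.
move=> j jk; rewrite linearB linearD !linearZ /=.
rewrite (split_coord_lt Hx _ jk) mulr0 add0r.
move: jk; rewrite ltnS leq_eqVlt => /orP[/eqP jk|jk].
  have -> : j = inord k by apply: val_inj; rewrite /= ik.
  have := split_coord_diag (inord k); rewrite ik => nz.
  by rewrite /split_coef divfK // subrr.
rewrite (split_coord_lt Hx _ jk) mulr0 subr0.
apply: (coord_raise_eq0 Hx (m := k.+1)) => // i ik'.
exact: (split_coord_lt Hx).
Qed.

Lemma split_coef_neq0 k : (k < d)%N -> split_coef k != 0.
Proof.
move=> kd; have ik : (inord k : 'I_d.+1) = k :> nat by rewrite inordK //; lia.
have kd1 : (k.+1 < d.+1)%N by [].
rewrite /split_coef (coord_raise Hx (j := Ordinal kd1)) ?ik //; last first.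
  by move=> i; apply: (split_coord_lt Hx).
have := split_coord_diag (inord k); rewrite ik => nz.
by rewrite !mulf_neq0 ?invr_eq0 ?(split_coord_diag (Ordinal kd1)) //
  (eigenbasis_near Hx) //= ik eqxx orbT.
Qed.

(** Apply [y ord0], an eigenfunctional of [As] for [ths 0], to [split_vec_dual]. The resulting
    quotient is the trace quotient in the definition of varphi. *)
Lemma split_dual_recr k : (k < d)%N ->
  (ths 0%N - ths k.+1) * y ord0 (u k.+1) = split_coef k * y ord0 (u k).
Proof.
move=> kd; have := congr1 (y ord0) (split_vec_dual kd).
rewrite linearD !linearZ /= (coord_eigen Hy) /= mulrBl => ->; ring.
Qed.

Lemma split_dual0_neq0 k : (k <= d)%N -> y ord0 (u k) != 0.
Proof.
elim: k => [_|k IH kd]; first exact: (split_dual_diag ord0).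
have : (ths 0%N - ths k.+1) * y ord0 (u k.+1) != 0.
  by rewrite split_dual_recr // mulf_neq0 ?IH ?split_coef_neq0 // ltnW.
by rewrite mulf_eq0 negb_or => /andP[].
Qed.

Lemma split_coef_ratio k : (k < d)%N ->
  split_coef k = (ths 0%N - ths k.+1) * (y ord0 (u k.+1) / y ord0 (u k)).
Proof.
by move=> kd; rewrite mulrA split_dual_recr // mulfK ?split_dual0_neq0 // ltnW.
Qed.

Lemma split_coef0_dual : (0 < d)%N ->
  split_coef 0%N = (y ord0 (A (f ord0)) - th 0%N) * (ths 0%N - ths 1%N).
Proof.
move=> d0; rewrite split_coef_ratio // /u split_vecS linearB linearZ /= split_vec0.
by rewrite (eigenbasis_delta Hy) eqxx mulr1 divr1 mulrC.
Qed.

(** Compare coordinate 0 in the expressions for [As (u 0)] and [As (u 1)], and eliminate the matrix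
    entry [c]. *)
Lemma split_coef0 : (0 < d)%N ->
  split_coef 0%N = (x ord0 (As (e ord0)) - ths 0%N) * (th 0%N - th 1%N).
Proof.
move=> d0; have d1 : (1 < d.+1)%N by [].
pose i1 := Ordinal d1; pose c := x ord0 (As (e i1)).
have x1_u1 : x i1 (u 1%N) = (th 1%N - th 0%N) * x i1 (u 0%N).
  by rewrite /u split_vecS linearB linearZ /= (coord_eigen Hx) mulrBl.
have c_u0 : c * x i1 (u 0%N) = (ths 0%N - x ord0 (As (e ord0))) * x ord0 (u 0%N).
  (* Removing the [e ord0] component makes [coord_raise] applicable. *)
  pose w := u 0%N - x ord0 (u 0%N) *: e ord0.
  have <- : x i1 w = x i1 (u 0%N).
    by rewrite linearB linearZ /= (eigenbasis_delta Hx) mulr0 subr0.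
  rewrite -(coord_raise Hx) //; last first.
    case=> [[|//] k0] _; have -> : Ordinal k0 = ord0 by apply: val_inj.
    by rewrite linearB linearZ /= (eigenbasis_delta Hx) eqxx mulr1 subrr.
  rewrite /w linearB linearZ /= linearB linearZ /= split_vec_dual0.
  rewrite linearZ /=; ring.
have c_u1 : c * x i1 (u 1%N) = split_coef 0%N * x ord0 (u 0%N).
  rewrite -(coord_raise Hx) //; last by move=> k; apply: (split_coord_lt Hx).
  rewrite split_vec_dual // linearD !linearZ /= (split_coord_lt Hx) //.
  by rewrite mulr0 add0r.
apply: (mulIf (coord_start_neq0 ord0)).
rewrite -(split_vec0 A th (f ord0)) -/(u 0%N) -c_u1 x1_u1.
by rewrite mulrCA c_u0; ring.
Qed.

(** Only the last coordinate of [u d] is nonzero, so the last coordinate of [As (u d)] involves a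
    single diagonal entry. *)
Lemma split_coef_last : (0 < d)%N ->
  split_coef d.-1 = (x ord_max (As (e ord_max)) - ths d) * (th d - th d.-1).
Proof.
move=> d0; have dd : (d.-1 < d)%N by lia.
have x_ud : x ord_max (u d) = (th d - th d.-1) * x ord_max (u d.-1).
  have -> : u d = A (u d.-1) - th d.-1 *: u d.-1.
    by rewrite -split_vecS prednK.
  by rewrite linearB linearZ /= (coord_eigen Hx) mulrBl.
have nz : x ord_max (u d) != 0 := split_coord_diag ord_max.
have := congr1 (x ord_max) (split_vec_dual dd).
rewrite linearD !linearZ /= prednK // (coord_tridiagonal Hx) (bigD1 ord_max) //=.
rewrite big1 ?addr0 => [E|j jd]; last first.
  rewrite (split_coord_lt Hx) ?mulr0 //; have jd' : (j != d :> nat) by [].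
  by have := ltn_ord j; lia.
move: nz; rewrite x_ud mulf_eq0 negb_or => /andP[_ nz].
apply: (mulIf nz); rewrite -[RHS]mulrA -x_ud mulrBl E; ring.
Qed.

End Split.

(** * A system is determined by its eigenvalues, varphi_1 and varphi_d *)

Lemma exists_diagonal_hom (F : fieldType) (V V' : vectType F) (n : nat)
    (x' : 'I_n -> {scalar V'}) (r : 'I_n -> F) (e : 'I_n -> V) :
  exists s : 'Hom(V', V), forall v, s v = \sum_i (r i * x' i v) *: e i.
Proof.
pose g v := \sum_i (r i * x' i v) *: e i.
have lin_g : linear g.
  move=> a v w; rewrite scaler_sumr -big_split; apply: eq_bigr => i _ /=.
  by rewrite linearP /= mulrDr scalerDl mulrCA scalerA.
pose gP := GRing.isLinear.Build F V' V _ g lin_g.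
pose G : {linear V' -> V} := HB.pack g gP.
by exists (linfun G) => v; rewrite lfunE.
Qed.

Section Uniqueness.
Variables (F : fieldType) (d : nat) (th ths : nat -> F) (b : F).
Variables (V V' : vectType F) (A As : 'End(V)) (A' As' : 'End(V')).
Variables (x y : 'I_d.+1 -> {scalar V}) (e f : 'I_d.+1 -> V).
Variables (x' y' : 'I_d.+1 -> {scalar V'}) (e' f' : 'I_d.+1 -> V').
Hypothesis Hx : tridiagonal_eigenbasis A As th x e.
Hypothesis Hy : tridiagonal_eigenbasis As A ths y f.
Hypothesis Hx' : tridiagonal_eigenbasis A' As' th x' e'.
Hypothesis Hy' : tridiagonal_eigenbasis As' A' ths y' f'.
Hypothesis d2 : (2 <= d)%N.
Hypothesis rec_th : recurrent d b th.

Let u := split_vec A th (f ord0).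
Let u' := split_vec A' th (f' ord0).
Let p := split_coef A As th x f.
Let p' := split_coef A' As' th x' f'.

Hypothesis p_first : p 0%N = p' 0%N.
Hypothesis p_last : p d.-1 = p' d.-1.

(** The scaling for which the diagonal map sends [f' ord0] to [f ord0], hence each [u' k] to
    [u k]. *)
Let r i := x i (f ord0) / x' i (f' ord0).

Let r_neq0 i : r i != 0.
Proof.
by rewrite mulf_neq0 ?invr_eq0 ?(coord_start_neq0 Hx Hy)
  ?(coord_start_neq0 Hx' Hy').
Qed.

(** * The intertwining map and its defect *)

Section Intertwiner.
Variable s : 'Hom(V', V).
Hypothesis sE : forall v, s v = \sum_i (r i * x' i v) *: e i.

Lemma coord_intertwiner i v : x i (s v) = r i * x' i v.
Proof.
rewrite sE linear_sum (bigD1 i) //= linearZ /= (eigenbasis_delta Hx) eqxx.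
rewrite mulr1 big1 ?addr0 // => j ji.
by rewrite linearZ /= (eigenbasis_delta Hx) eq_sym (negPf ji) mulr0.
Qed.

Lemma intertwiner_bij : bijective s.
Proof.
exists (fun v => \sum_i (x i v / r i) *: e' i) => v.
  rewrite [RHS](eigenbasis_expand Hx'); apply: eq_bigr => i _.
  by rewrite coord_intertwiner mulrAC divff ?mul1r.
apply: (coord_inj Hx) => i; rewrite coord_intertwiner.
rewrite linear_sum (bigD1 i) //= linearZ /= (eigenbasis_delta Hx') eqxx mulr1.
rewrite big1 ?addr0 => [|j ji]; first by rewrite mulrC divfK.
by rewrite linearZ /= (eigenbasis_delta Hx') eq_sym (negPf ji) mulr0.
Qed.

Lemma intertwiner_A v : s (A' v) = A (s v).
Proof.
apply: (coord_inj Hx) => i; rewrite (coord_eigen Hx) !coord_intertwiner.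
by rewrite (coord_eigen Hx') mulrCA.
Qed.

Lemma intertwiner_eigenvector j : s (e' j) = r j *: e j.
Proof.
apply: (coord_inj Hx) => i; rewrite coord_intertwiner linearZ /=.
rewrite (eigenbasis_delta Hx) (eigenbasis_delta Hx').
by case: eqP => [->|_] //; rewrite !mulr0.
Qed.

Lemma intertwiner_split k : s (u' k) = u k.
Proof.
apply: (coord_inj Hx) => i; rewrite coord_intertwiner.
rewrite (coord_split_vec Hx) (coord_split_vec Hx') mulrCA.
by rewrite divfK ?(coord_start_neq0 Hx' Hy').
Qed.

Let D : 'Hom(V', V) := ((As \o s) - (s \o As'))%VF.

Let DE v : D v = As (s v) - s (As' v).
Proof. by rewrite add_lfunE opp_lfunE !comp_lfunE. Qed.

Let D0 : D (u' 0%N) = 0.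
Proof.
rewrite DE intertwiner_split (split_vec_dual0 _ Hy) (split_vec_dual0 _ Hy').
by rewrite linearZ /= intertwiner_split subrr.
Qed.

(** Both systems share [ths], so the eigenvalue terms cancel. *)
Let DS k : (k < d)%N -> D (u' k.+1) = (p k - p' k) *: u k.
Proof.
move=> kd; rewrite DE intertwiner_split (split_vec_dual Hx Hy kd).
rewrite (split_vec_dual Hx' Hy' kd) linearD !linearZ /= !intertwiner_split.
by rewrite opprD addrACA subrr add0r scalerBl.
Qed.

Let gamma := rec_const b th.
Let rho := th 0%N ^+ 2 - b * th 0%N * th 1%N + th 1%N ^+ 2
  - gamma * (th 0%N + th 1%N).

Let Y v : V := A (A (D v)) - b *: A (D (A' v)) + D (A' (A' v))
  - gamma *: (A (D v) + D (A' v)) - rho *: D v.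

Let coordD i v : x i (D v) = \sum_j x i (D (e' j)) * x' j v.
Proof.
rewrite {1}(eigenbasis_expand Hx' v) !linear_sum; apply: eq_bigr => j _.
by rewrite !linearZ /= mulrC.
Qed.

Let D_far (i j : 'I_d.+1) :
  (i.+1 < j)%N || (j.+1 < i)%N -> x i (D (e' j)) = 0.
Proof.
move=> ij; rewrite DE linearB /= coord_intertwiner intertwiner_eigenvector.
by rewrite !linearZ /= (eigenbasis_far Hx ij) (eigenbasis_far Hx' ij) !mulr0 subrr.
Qed.

(* [Y] is diagonal: off the diagonal, either [D] has a zero entry or the
   quadratic form attached to the recurrence vanishes. *)
Let m i := x i (D (e' i)) *
  (th i ^+ 2 - b * th i * th i + th i ^+ 2 - gamma * (th i + th i) - rho).

Let coordY i v : x i (Y v) = m i * x' i v.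
Proof.
have E : x i (Y v) = \sum_j x i (D (e' j)) *
    (th i ^+ 2 - b * th i * th j + th j ^+ 2 - gamma * (th i + th j) - rho)
    * x' j v.
  rewrite /Y !(linearB, linearD, linearZ) /= !(coord_eigen Hx) !coordD.
  have e1 : \sum_j x i (D (e' j)) * x' j (A' v)
          = \sum_j x i (D (e' j)) * (th j * x' j v).
    by apply: eq_bigr => j _; rewrite (coord_eigen Hx').
  have e2 : \sum_j x i (D (e' j)) * x' j (A' (A' v))
          = \sum_j x i (D (e' j)) * (th j * (th j * x' j v)).
    by apply: eq_bigr => j _; rewrite !(coord_eigen Hx').
  rewrite e1 e2; symmetry.
  have e3 j : x i (D (e' j)) *
        (th i ^+ 2 - b * th i * th j + th j ^+ 2 - gamma * (th i + th j) - rho)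
        * x' j v
      = (th i ^+ 2 - gamma * th i - rho) * (x i (D (e' j)) * x' j v)
        + (- (b * th i) - gamma) * (x i (D (e' j)) * (th j * x' j v))
        + x i (D (e' j)) * (th j * (th j * x' j v)) by ring.
  rewrite (eq_bigr _ (fun j _ => e3 j)).
  rewrite !big_split -!mulr_sumr /=; ring.
rewrite E (bigD1 i) //= big1 ?addr0 // => j ji.
have ji' : (j != i :> nat) by [].
have [ij|ij|ij] := ltngtP j i.+1.
- have [jj|jj] := leqP i j.+1; last first.
    by rewrite D_far ?mul0r // jj orbT.
  have jE : i = j.+1 :> nat by move: ij; lia.
  have jd : (j < d)%N by have := ltn_ord i; lia.
  have := recurrent_quadratic rec_th jd; rewrite -jE -/gamma -/rho => <-.
  by ring.
- by rewrite D_far ?mul0r // ij.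
- have id : (i < d)%N by have := ltn_ord j; lia.
  have := recurrent_quadratic rec_th id; rewrite -ij -/gamma -/rho => <-.
  by ring.
Qed.

Let Au' k : A' (u' k) = u' k.+1 + th k *: u' k.
Proof. by rewrite /u' split_vecS subrK. Qed.

Lemma intertwiner_As v : s (As' v) = As (s v).
Proof.
have D1 : D (u' 1%N) = 0 by rewrite DS ?p_first ?subrr ?scale0r //; lia.
have Dd : D (u' d) = 0.
  by rewrite -(ltn_predK d2) DS ?p_last ?subrr ?scale0r //; lia.
(* Every index is below [d.+1]; thus [u' d] is an eigenvector of [A']. *)
have u'd : u' d.+1 = 0.
  by apply: (coord_eq0 Hx') => i; apply: (split_coord_lt Hx').
(* Only the term [D (A' (A' _))] survives, through [D (u' 2)]. *)
have Y0 : Y (u' 0%N) = (p 1%N - p' 1%N) *: u 1%N.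
  rewrite /Y !Au' !(linearD, linearZ) /= !Au' !(linearD, linearZ) /= D0 D1 DS //.
  by rewrite !(linear0, scaler0, addr0, subr0, add0r).
have Yd : Y (u' d) = 0.
  rewrite /Y !Au' u'd add0r !linearZ /= !Au' u'd add0r !linearZ /= Dd.
  by rewrite !(linear0, scaler0, addr0, subr0, add0r).
have md : m ord_max = 0.
  have := coordY ord_max (u' d); rewrite Yd linear0 => /esym/eqP.
  by rewrite mulf_eq0 (negPf (split_coord_diag Hx' Hy' ord_max)) orbF => /eqP.
have mE i :
    m i * x' i (u' 0%N) = (p 1%N - p' 1%N) * ((th i - th 0%N) * x i (u 0%N)).
  have := coordY i (u' 0%N); rewrite Y0 linearZ /= /u split_vecS linearB linearZ /=.
  by rewrite (coord_eigen Hx) -mulrBl => <-.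
have u0nz i : x i (u 0%N) != 0 by rewrite /u split_vec0 (coord_start_neq0 Hx Hy).
have u'0nz i : x' i (u' 0%N) != 0.
  by rewrite /u' split_vec0 (coord_start_neq0 Hx' Hy').
(* Evaluate [mE] at the last index, where [m] vanishes but [th d - th 0] does not. *)
have p1 : p 1%N - p' 1%N = 0.
  have := mE ord_max; rewrite md mul0r => /esym/eqP.
  rewrite !mulf_eq0 (negPf (u0nz _)) orbF orbC subr_eq0.
  by rewrite (negPf (eigenbasis_th_neq Hx _ _ _)) //=; [move/eqP | lia].
have m0 i : m i = 0.
  have := mE i; rewrite p1 mul0r => /eqP.
  by rewrite mulf_eq0 (negPf (u'0nz i)) orbF => /eqP.
have Yz w : Y w = 0 by apply: (coord_eq0 Hx) => i; rewrite coordY m0 mul0r.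
(* In [Y (u' k) = 0] the terms with [D (u' k)] and [D (u' k.+1)] drop out, leaving
   [D (u' k.+2) = 0]. *)
have Du' k : D (u' k) = 0 /\ D (u' k.+1) = 0.
  elim: k => // k [IH0 IH1]; split=> //.
  rewrite -(Yz (u' k)) /Y !Au' !(linearD, linearZ) /= !Au'.
  rewrite !(linearD, linearZ) /= IH0 IH1.
  by rewrite !(linear0, scaler0, addr0, subr0, add0r).
apply/eqP; rewrite eq_sym -subr_eq0 -DE -memv_ker.
apply: (split_vec_full (th := th) Hy') => k _; rewrite memv_ker.
by apply/eqP; case: (Du' k).
Qed.

End Intertwiner.

Theorem split_data_determine : exists s : 'Hom(V', V),
  [/\ bijective s, forall v, s (A' v) = A (s v) & forall v, s (As' v) = As (s v)].
Proof.
have [s sE] := exists_diagonal_hom x' r e.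
exists s; split; [exact: intertwiner_bij | exact: intertwiner_A |].
exact: intertwiner_As.
Qed.

End Uniqueness.

(** * Idempotents and traces *)

(** Expanding the reference basis through [e] gives a double sum; exchanging the summations
    collapses it. *)
Lemma lfun_trace_coord (F : fieldType) (V : vectType F) (n : nat)
    (x : 'I_n -> {scalar V}) (e : 'I_n -> V) (f : 'End(V)) :
  (forall v, v = \sum_i x i v *: e i) -> lfun_trace f = \sum_i x i (f (e i)).
Proof.
move=> xe; rewrite /lfun_trace /mxtrace.
pose v := vbasis {:V}.
transitivity (\sum_(k < \dim {:V}) \sum_i x i v`_k * coord v k (f (e i))).
  apply: eq_bigr => k _; rewrite !mxE /= vecof_delta.
  rewrite {1}(xe v`_k) !linear_sum; apply: eq_bigr => i _.
  by rewrite !linearZ.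
rewrite exchange_big; apply: eq_bigr => i _ /=.
rewrite {2}(coord_vbasis (memvf (f (e i)))) linear_sum; apply: eq_bigr => k _.
by rewrite linearZ mulrC.
Qed.

Section Idempotents.
Variables (F : fieldType) (V : vectType F) (A : 'End(V)).

Lemma mem_leigenspace a v : (v \in leigenspace A a) = (A v == a *: v).
Proof. by rewrite memv_ker add_lfunE opp_lfunE scale_lfunE id_lfunE subr_eq0. Qed.

Lemma primitive_idempotentE a a' E v : primitive_idempotent A a E ->
  leigenvalue A a' -> A v = a' *: v -> E v = (a' == a)%:R *: v.
Proof.
move=> [_ E1 E0] la' /eqP; rewrite -mem_leigenspace => Av.
have [aa|aa] := eqVneq a' a; last by rewrite scale0r; apply: E0 Av.
by rewrite scale1r E1 // -aa.
Qed.

Lemma primitive_idempotent_inj a a' E :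
  primitive_idempotent A a E -> primitive_idempotent A a' E -> a = a'.
Proof.
move=> [la E1 _] [_ _ E0]; apply/eqP; apply: contraTT (la) => aa'.
have : vpick (leigenspace A a) = 0.
  by rewrite -(E1 _ (memv_pick _)) (E0 a) ?memv_pick.
by move/eqP; rewrite vpick0 negbK.
Qed.

End Idempotents.

Lemma standard_ordering_eigenbasis (F : fieldType) (V : vectType F) (d : nat)
    (A As : 'End(V)) (E : 'I_d.+1 -> 'End(V)) (theta : 'I_d.+1 -> F) :
    standard_ordering A As E ->
    (forall i, primitive_idempotent A (theta i) (E i)) ->
  exists (x : 'I_d.+1 -> {scalar V}) (e : 'I_d.+1 -> V),
    tridiagonal_eigenbasis A As (fun k => theta (inord k)) x e /\
    (forall i j, E i (e j) = (i == j)%:R *: e j).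
Proof.
move=> [[injE _] std] hE.
pose w i := vpick (leigenspace A (theta i)).
have Aw i : A (w i) = theta i *: w i.
  by apply/eqP; rewrite -mem_leigenspace memv_pick.
have la i : leigenvalue A (theta i) by case: (hE i).
have w0 i : w i != 0 by rewrite vpick0; apply: la.
have Ew i j : E i (w j) = (theta j == theta i)%:R *: w j.
  by apply: primitive_idempotentE (hE i) (la j) (Aw j).
pose e := [tuple w i | i < d.+1].
have eE (i : 'I_d.+1) : e`_i = w i by rewrite -tnth_nth tnth_mktuple.
have [|basis_e irr_e _] := std e.
  move=> i; rewrite eE w0; split=> //.
  have -> : w i = E i (w i) by rewrite Ew eqxx scale1r.
  by rewrite memv_img ?memvf.
have expand v : v = \sum_i coord e i v *: w i.
  rewrite {1}(coord_basis basis_e (memvf v)).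
  by apply: eq_bigr => i _; rewrite eE.
(* Equal eigenvalues would make [E i] and [E j] agree on the eigenbasis. *)
have inj_theta i j : theta i = theta j -> i = j.
  move=> ij; apply: injE; apply/lfunP => v; rewrite (expand v) !linear_sum.
  by apply: eq_bigr => k _; rewrite !linearZ /= !Ew ij.
exists (fun i => coord e i), w; split; last first.
  by move=> i j; rewrite Ew (inj_eq inj_theta) eq_sym.
split=> //.
- move=> i j; rewrite -(eE j) eq_sym; exact: (coord_free _ _ (basis_free basis_e)).
- by move=> i; rewrite inord_val.
- by move=> i j; rewrite !inord_val; apply: inj_theta.
have -> // : \matrix_(i, j) coord e i (As (w j)) = lfun_mx e As.
by apply/matrixP => i j; rewrite !mxE eE.
Qed.

(** [s] sends an eigenvector of [A'] to a vector on which [A] acts by the same scalar, so both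
    composites scale it alike. *)
Lemma idempotent_intertwiner (F : fieldType) (V V' : vectType F) (n : nat)
    (A : 'End(V)) (A' : 'End(V')) (theta : 'I_n -> F)
    (E : 'I_n -> 'End(V)) (E' : 'I_n -> 'End(V'))
    (x' : 'I_n -> {scalar V'}) (e' : 'I_n -> V') (s : 'Hom(V', V)) :
    (forall i, primitive_idempotent A (theta i) (E i)) ->
    (forall i, primitive_idempotent A' (theta i) (E' i)) ->
    (forall v, v = \sum_i x' i v *: e' i) ->
    (forall i, A' (e' i) = theta i *: e' i) ->
    (forall v, s (A' v) = A (s v)) ->
  forall i, (s \o E' i = E i \o s)%VF.
Proof.
move=> hE hE' expand' eig' sA i; apply/lfunP => v; rewrite !comp_lfunE.
rewrite (expand' v) !linear_sum; apply: eq_bigr => j _; rewrite !linearZ /=.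
congr (_ *: _); have [la _ _] := hE j; have [la' _ _] := hE' j.
rewrite (primitive_idempotentE (hE' i) la' (eig' j)) linearZ /=.
by rewrite (primitive_idempotentE (hE i) la) // -sA eig' linearZ.
Qed.

Section Traces.
Variables (F : fieldType) (V : vectType F) (d : nat) (A As : 'End(V)).
Variables (th ths : nat -> F).
Variables (x y : 'I_d.+1 -> {scalar V}) (e f : 'I_d.+1 -> V).
Variable (Es : 'I_d.+1 -> 'End(V)).
Hypothesis Hx : tridiagonal_eigenbasis A As th x e.
Hypothesis Hy : tridiagonal_eigenbasis As A ths y f.
Hypothesis Es_f : forall i j, Es i (f j) = (i == j)%:R *: f j.

Lemma lfun_trace_idempotent (B : 'End(V)) i :
  lfun_trace (B \o Es i)%VF = y i (B (f i)).
Proof.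
rewrite (lfun_trace_coord _ (eigenbasis_expand Hy)) (bigD1 i) //=.
rewrite big1 ?addr0 => [|j ji]; rewrite comp_lfunE Es_f.
  by rewrite eqxx scale1r.
by rewrite eq_sym (negPf ji) scale0r !linear0.
Qed.

Lemma lfun_trace_idempotentl (B : 'End(V)) i :
  lfun_trace (Es i \o B)%VF = y i (B (f i)).
Proof.
have yE j v : y j (Es i v) = (j == i)%:R * y i v.
  rewrite {1}(eigenbasis_expand Hy v) !linear_sum (bigD1 i) //= !linearZ /=.
  rewrite Es_f eqxx scale1r (eigenbasis_delta Hy) mulrC big1 ?addr0 // => k ki.
  by rewrite !linearZ /= Es_f eq_sym (negPf ki) scale0r linear0 mulr0.
rewrite (lfun_trace_coord _ (eigenbasis_expand Hy)) (bigD1 i) //=.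
rewrite big1 ?addr0 => [|j ji]; rewrite comp_lfunE yE.
  by rewrite eqxx mul1r.
by rewrite (negPf ji) mul0r.
Qed.

(** The composition and the recursion apply the factors in opposite orders; in the coordinates [x]
    both are the same product of scalars. *)
Lemma split_trace_vec (theta : 'I_d.+1 -> F) k : (k <= d.+1)%N ->
  (forall h : 'I_d.+1, theta h = th h) ->
  lfun_trace (Es ord0 \o
     \big[(@comp_lfun F V V V) / \1]_(h < d.+1 | (h < k)%N)
        (A - theta h *: \1))%VF = y ord0 (split_vec A th (f ord0) k).
Proof.
move=> kd thE; rewrite lfun_trace_idempotentl; congr (y _ _).
apply: (coord_inj Hx) => i; rewrite (coord_split_vec Hx).
rewrite (big_ord_widen _ (fun h => th i - th h) kd).
move: (f ord0).
apply: (big_rec2 (fun (g : 'End(V)) c => forall v, x i (g v) = c * x i v)).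
  by move=> v; rewrite id_lfunE mul1r.
move=> h c g _ IH v; rewrite comp_lfunE add_lfunE opp_lfunE scale_lfunE id_lfunE.
by rewrite linearB linearZ /= (coord_eigen Hx) -mulrBl IH thE mulrA.
Qed.

End Traces.

(** * End-entries *)

(* Used with [X = th 0 - th 1], [X' = th d - th d.-1] and [Y = ths 0 - ths 1]: then
   [al * Y = be * X] is varphi_1 and [ga * Y = de * X'] is phi_1. *)
Lemma end_gaps_unique (F : fieldType) (al be ga de X X' Y Z Z' W K : F) :
    al != 0 -> ga != 0 -> Y != 0 -> K != 0 ->
    al * Y = be * X -> ga * Y = de * X' -> X - X' = K ->
    al * W = be * Z -> ga * W = de * Z' -> Z - Z' = K ->
  [/\ X = Z, X' = Z' & Y = W].
Proof.
move=> al0 ga0 Y0 K0 e1 e2 e3 f1 f2 f3.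
have P0 : be * ga * X != 0.
  by rewrite mulrAC -e1 !mulf_neq0.
(* Eliminate [Y]; the same is done with [W] for the second solution. *)
have eX : be * ga * X = al * de * X'.
  by rewrite mulrAC -e1 -[RHS]mulrA -e2; ring.
have fX : be * ga * Z = al * de * Z'.
  by rewrite mulrAC -f1 -[RHS]mulrA -f2; ring.
have XZ : X = Z.
  have E : (be * ga - al * de) * (X - Z) = 0.
    have -> : (be * ga - al * de) * (X - Z) =
      (be * ga * X - be * ga * Z) - al * de * (X' - Z')
      - al * de * ((X - X') - (Z - Z')) by ring.
    by rewrite eX fX e3 f3; ring.
  (* If [be * ga = al * de], then [eX] gives [X = X'], against [K != 0]. *)
  move/eqP: E; rewrite mulf_eq0 !subr_eq0 => /orP[/eqP E|/eqP //].
  have Q0 : al * de != 0.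
    by rewrite -E; move: P0; rewrite mulf_eq0 negb_or => /andP[].
  move: eX; rewrite E => /(mulfI Q0) XX.
  by move: K0; rewrite -e3 XX subrr eqxx.
split=> //; first by apply/eqP; rewrite -(inj_eq (subrI X)) e3 XZ f3.
by apply: (mulfI al0); rewrite e1 f1 XZ.
Qed.

(** * Eigenbases and recurrences of a Leonard system *)

Section System.
Variables (F : fieldType) (d : nat) (V : vectType F).
Variable Phi : leonard_system d V.
Variables theta thetas : 'I_d.+1 -> F.
Hypothesis hth : eigenvalue_sequence Phi theta.
Hypothesis hths : dual_eigenvalue_sequence Phi thetas.

Lemma eigenvalue_sequence_unique theta' :
  eigenvalue_sequence Phi theta' -> theta' =1 theta.
Proof. by move=> h i; apply: primitive_idempotent_inj (h i) (hth i). Qed.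

Lemma dual_eigenvalue_sequence_unique thetas' :
  dual_eigenvalue_sequence Phi thetas' -> thetas' =1 thetas.
Proof. by move=> h i; apply: primitive_idempotent_inj (h i) (hths i). Qed.

Let th k := theta (inord k).
Let ths k := thetas (inord k).

Lemma leonard_system_bases :
  exists (x y : 'I_d.+1 -> {scalar V}) (e f : 'I_d.+1 -> V),
  [/\ tridiagonal_eigenbasis (ls_A Phi) (ls_As Phi) th x e,
      tridiagonal_eigenbasis (ls_As Phi) (ls_A Phi) ths y f,
      forall i j, ls_Es Phi i (f j) = (i == j)%:R *: f j,
      forall i, principal_sequence Phi i = y i (ls_A Phi (f i))
    & forall i, dual_principal_sequence Phi i = x i (ls_As Phi (e i))].
Proof.
have [x [e [Hx Ee]]] := standard_ordering_eigenbasis (ls_standardE Phi) hth.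
have [y [f [Hy Ef]]] := standard_ordering_eigenbasis (ls_standardEs Phi) hths.
exists x, y, e, f; split=> // i.
  exact: (lfun_trace_idempotent Hy Ef).
exact: (lfun_trace_idempotent Hx Ee).
Qed.

(** Clear the denominators, nonzero by distinctness of the eigenvalues; index [i] of [recurrent] is
    index [i.+2] of the ratio. *)
Lemma fundamental_parameter_recurrent b : fundamental_parameter Phi b ->
  recurrent d b th /\ recurrent d b ths.
Proof.
move=> [theta' [thetas' [h h' hb]]].
have E := eigenvalue_sequence_unique h.
have E' := dual_eigenvalue_sequence_unique h'.
have [x [y [e [f [Hx Hy _ _ _]]]]] := leonard_system_bases.
have nz t (z : 'I_d.+1 -> {scalar V}) c (B Bs : 'End(V)) :
    tridiagonal_eigenbasis B Bs t z c ->
    forall i, (i.+3 <= d)%N -> t i.+1 - t i.+2 != 0.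
  move=> Hz i hi; rewrite subr_eq0 (eigenbasis_th_neq Hz) //; lia.
split=> i hi.
- have [|/esym/eqP + _] := hb i.+2; first by lia.
  rewrite /eigenvalue_ratio !E subr_eq -!/(th _) /= subSS subSS subn0.
  by move/eqP <-; rewrite divfK // (nz _ _ _ _ _ Hx).
- have [|_ /esym/eqP] := hb i.+2; first by lia.
  rewrite /eigenvalue_ratio !E' subr_eq -!/(ths _) /= subSS subSS subn0.
  by move/eqP <-; rewrite divfK // (nz _ _ _ _ _ Hy).
Qed.

End System.

(** * Relations between end-entries and split coefficients *)

Section EndEntries.
Variables (F : fieldType) (V : vectType F) (d : nat) (A As : 'End(V)).
Variables (th ths : nat -> F).
Variables (x y : 'I_d.+1 -> {scalar V}) (e f : 'I_d.+1 -> V).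
Hypothesis Hx : tridiagonal_eigenbasis A As th x e.
Hypothesis Hy : tridiagonal_eigenbasis As A ths y f.
Hypothesis d0 : (0 < d)%N.

Let a0 := y ord0 (A (f ord0)).
Let as0 := x ord0 (As (e ord0)).
Let asd := x ord_max (As (e ord_max)).
Let rth i := th (d - i)%N.
Let rx i := x (rev_ord i).
Let p := split_coef A As th x f.
Let q := split_coef A As rth rx f.

Let Hr := eigenbasis_rev Hx.

Let rev0 : rev_ord ord0 = ord_max :> 'I_d.+1.
Proof. by apply: val_inj; rewrite /= subn1. Qed.

Let revd : rev_ord ord_max = ord0 :> 'I_d.+1.
Proof. by apply: val_inj; rewrite /= subnn. Qed.

Lemma split_coef0_rev_dual : q 0%N = (a0 - th d) * (ths 0%N - ths 1%N).
Proof. by rewrite /q (split_coef0_dual Hr Hy) // /rth subn0. Qed.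

Lemma split_coef0_rev : q 0%N = (asd - ths 0%N) * (th d - th d.-1).
Proof. by rewrite /q (split_coef0 Hr Hy) // /rth rev0 subn0 subn1. Qed.

Lemma split_coef_last_rev : q d.-1 = (as0 - ths d) * (th 0%N - th 1%N).
Proof.
rewrite /q (split_coef_last Hr Hy) // /rth revd subnn.
by have -> : (d - d.-1)%N = 1%N by lia.
Qed.

Lemma end_entry_relation :
  (a0 - th 0%N) * (ths 0%N - ths 1%N) = (as0 - ths 0%N) * (th 0%N - th 1%N).
Proof. by rewrite -(split_coef0_dual Hx Hy) // -(split_coef0 Hx Hy). Qed.

Lemma end_entry_relation_rev :
  (a0 - th d) * (ths 0%N - ths 1%N) = (asd - ths 0%N) * (th d - th d.-1).
Proof. by rewrite -split_coef0_rev_dual split_coef0_rev. Qed.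

(** These scalars are factors of varphi_1 and phi_1, which are nonzero. *)
Lemma end_entry_neq0 : (a0 - th 0%N != 0) /\ (a0 - th d != 0).
Proof.
have := split_coef_neq0 Hx Hy d0; rewrite (split_coef0_dual Hx Hy) //.
rewrite mulf_eq0 negb_or => /andP[-> _].
have := split_coef_neq0 Hr Hy d0; rewrite -/q split_coef0_rev_dual.
by rewrite mulf_eq0 negb_or => /andP[-> _].
Qed.

Lemma split_coef_sums :
  p 0%N + p d.-1 - (q 0%N + q d.-1)
    = (ths 0%N - ths d) * ((th d - th d.-1) - (th 0%N - th 1%N)).
Proof.
have r1 := end_entry_relation; have r2 := end_entry_relation_rev.
rewrite split_coef0_rev_dual split_coef_last_rev /p (split_coef0_dual Hx Hy) //.
rewrite (split_coef_last Hx Hy) // r1 r2 -/asd -/as0; ring.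
Qed.

End EndEntries.

(** * The parameter array and the main theorem *)

Section ParameterArray.
Variables (F : fieldType) (d : nat) (V : vectType F).
Variable Phi : leonard_system d V.
Variables theta thetas : 'I_d.+1 -> F.
Let A := ls_A Phi.
Let As := ls_As Phi.
Let th k := theta (inord k).
Let ths k := thetas (inord k).
Variables (x y : 'I_d.+1 -> {scalar V}) (e f : 'I_d.+1 -> V).
Hypothesis Hx : tridiagonal_eigenbasis A As th x e.
Hypothesis Hy : tridiagonal_eigenbasis As A ths y f.
Hypothesis Es_f : forall i j, ls_Es Phi i (f j) = (i == j)%:R *: f j.

Lemma split_value_coef k : (k < d)%N ->
  split_value Phi theta thetas k.+1 = split_coef A As th x f k.
Proof.
move=> kd; rewrite (split_coef_ratio Hx Hy kd) /split_value /split_trace.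
rewrite !(split_trace_vec Hx Hy Es_f (th := th)) //; try lia.
- by rewrite -[thetas (inord _)]/(ths _) /ths; congr ((thetas _ - _) * _);
    apply: val_inj; rewrite /= inordK.
- by move=> h; rewrite /th inord_val.
- by move=> h; rewrite /th inord_val.
Qed.

Lemma split_value_coef_rev k : (k < d)%N ->
  split_value Phi (fun h => theta (rev_ord h)) thetas k.+1
  = split_coef A As (fun i => th (d - i)%N) (fun i => x (rev_ord i)) f k.
Proof.
have Hr := eigenbasis_rev Hx.
have thE (h : 'I_d.+1) : theta (rev_ord h) = th (d - h)%N.
  by rewrite /th; congr theta; apply: val_inj; rewrite /= subSS inordK //; lia.
move=> kd; rewrite (split_coef_ratio Hr Hy kd) /split_value /split_trace.
rewrite !(split_trace_vec Hr Hy Es_f) //; try lia.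
congr ((thetas _ - _) * _); apply: val_inj; by rewrite /= inordK.
Qed.

End ParameterArray.

Theorem theorem1p11 (F : closedFieldType) (d : nat) (hd : (3 <= d)%N)
    (V : vectType F) (Phi : leonard_system d V)
    (theta thetas : 'I_d.+1 -> F) (varphi phi : nat -> F)
    (hPhi : parameter_array Phi theta thetas varphi phi)
    (hneq : varphi 1%N + varphi d <> phi 1%N + phi d)
    (V' : vectType F) (Phi' : leonard_system d V')
    (hbeta : same_fundamental_parameter Phi' Phi)
    (hend : same_end_entries Phi' Phi) :
  isomorphic Phi' Phi.
Proof.
have [hth hths hvarphi hphi] := hPhi.
have [b [fb' fb]] := hbeta.
have [es [[t' [ts' [ht' hts' ->]]] [t [ts [ht hts]]]]] := hend.
rewrite !(eigenvalue_sequence_unique hth ht).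
rewrite !(dual_eigenvalue_sequence_unique hths hts).
case=> e_th0 e_thd e_ths0 e_thsd e_a0 _ e_as0 e_asd.
have [d0 d2] : (0 < d)%N /\ (2 <= d)%N by lia.
pose th k := theta (inord k); pose ths k := thetas (inord k).
pose th' k := t' (inord k); pose ths' k := ts' (inord k).
have ord0E : ord0 = inord 0 :> 'I_d.+1 by apply: val_inj; rewrite /= inordK.
have ordmE : ord_max = inord d :> 'I_d.+1 by apply: val_inj; rewrite /= inordK.
rewrite ord0E ordmE -/(th 0%N) -/(th d) -/(th' 0%N) -/(th' d) in e_th0 e_thd.
rewrite ord0E ordmE -/(ths 0%N) -/(ths d) -/(ths' 0%N) -/(ths' d) in e_ths0 e_thsd.
have [rth rths] := fundamental_parameter_recurrent hth hths fb.
have [rth' rths'] := fundamental_parameter_recurrent ht' hts' fb'.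
have [x [y [e [f [Hx Hy Ef a_E as_E]]]]] := leonard_system_bases hth hths.
(* Both factors on the right of [split_coef_sums] are nonzero, since the left side is by
   hypothesis. *)
have gaps : th 0%N - th 1%N != th d - th d.-1 /\ ths 0%N != ths d.
  have := split_coef_sums Hx Hy d0.
  have dd : (d.-1 < d)%N by lia.
  rewrite -!(split_value_coef Hx Hy Ef) // -!(split_value_coef_rev Hx Hy Ef) //.
  rewrite prednK // -!hvarphi ?leqnn ?andbT // -!hphi ?leqnn ?andbT //.
  move=> E; split; apply/negP => /eqP E'; apply: hneq; apply/eqP.
    by rewrite -subr_eq0 E -/(th _) -!/(th _) E' subrr mulr0.
  by rewrite -subr_eq0 E -!/(ths _) E' subrr mul0r.
have [gap_th gap_ths0] := gaps.
have th_neq i j : (i <= d)%N -> (j <= d)%N -> i != j -> th i != th j.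
  exact: (eigenbasis_th_neq Hx).
have ths_neq i j : (i <= d)%N -> (j <= d)%N -> i != j -> ths i != ths j.
  exact: (eigenbasis_th_neq Hy).
have th0d : th 0%N - th d != 0 by rewrite subr_eq0 th_neq //; lia.
have ths0d : ths 0%N - ths d != 0 by rewrite subr_eq0 ths_neq //; lia.
(* The antisymmetry relation for the mixed pair [th], [th'], whose end values agree. *)
have e_th : th' 1%N - th' d.-1 = th 1%N - th d.-1.
  apply: (mulfI th0d); rewrite (recurrent_antisymmetric d0 rth rth').
  by rewrite -!/(th' _) e_th0 e_thd mulrC.
have e_ths : ths' 1%N - ths' d.-1 = ths 1%N - ths d.-1.
  apply: (mulfI ths0d); rewrite (recurrent_antisymmetric d0 rths rths').
  by rewrite -!/(ths' _) e_ths0 e_thsd mulrC.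
(* Antisymmetry for [th], [ths] carries a vanishing dual gap over to [th]. *)
have gap_ths : ths 0%N - ths 1%N != ths d - ths d.-1.
  apply: contraNneq gap_th => E.
  have := recurrent_antisymmetric d0 rth rths; rewrite -!/(th _) -!/(ths _).
  have -> : ths 1%N - ths d.-1 = ths 0%N - ths d.
    apply/eqP; rewrite -subr_eq0 -(subrr (ths d - ths d.-1)) -{2}E.
    by apply/eqP; ring.
  move/(mulIf ths0d) => E'.
  by rewrite -subr_eq0 -(subrr (th 0%N - th d)) {2}E'; apply/eqP; ring.
have [x' [y' [e' [f' [Hx' Hy' Ef' a_E' as_E']]]]] := leonard_system_bases ht' hts'.
have [a0_th0 a0_thd] := end_entry_neq0 Hx Hy d0.
have r := end_entry_relation Hx Hy d0.
have rr := end_entry_relation_rev Hx Hy d0.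
have r' := end_entry_relation Hx' Hy' d0.
have rr' := end_entry_relation_rev Hx' Hy' d0.
rewrite -a_E' -as_E' e_a0 e_as0 a_E as_E -/(th' _) -!/(ths' _) e_th0 e_ths0 in r'.
rewrite -a_E' -as_E' e_a0 e_asd a_E as_E -!/(th' _) -!/(ths' _) e_thd e_ths0 in rr'.
have gapY : ths 0%N - ths 1%N != 0 by rewrite subr_eq0 ths_neq //; lia.
have gapK : th 0%N - th 1%N - (th d - th d.-1) != 0 by rewrite subr_eq0.
have gapE :
    th 0%N - th' 1%N - (th d - th' d.-1) = th 0%N - th 1%N - (th d - th d.-1).
  apply/eqP; rewrite -subr_eq0 -(subrr (th 1%N - th d.-1)) -{2}e_th; apply/eqP.
  by ring.
have [E1 Ed1 Es1] :=
  end_gaps_unique a0_th0 a0_thd gapY gapK r rr (erefl _) r' rr' gapE.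
have {E1} e_th1 : th' 1%N = th 1%N by apply: (subrI (th 0%N)).
have {Ed1} e_thd1 : th' d.-1 = th d.-1 by apply: (subrI (th d)).
have {Es1} e_ths1 : ths' 1%N = ths 1%N by apply: (subrI (ths 0%N)).
have e_thsd1 : ths' d.-1 = ths d.-1.
  by apply: (subrI (ths 1%N)); rewrite -e_ths e_ths1.
have th'E k : (k <= d)%N -> th k = th' k.
  apply: (recurrent_unique hd rth rth') => //; apply: th_neq; lia.
have ths'E k : (k <= d)%N -> ths k = ths' k.
  apply: (recurrent_unique hd rths rths') => //; apply: ths_neq; lia.
have hth' : eigenvalue_sequence Phi' theta.
  move=> i; have := th'E i; rewrite /th /th' inord_val => -> //.
  by rewrite -ltnS.
have hths' : dual_eigenvalue_sequence Phi' thetas.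
  move=> i; have := ths'E i; rewrite /ths /ths' inord_val => -> //.
  by rewrite -ltnS.
(* The bases are taken anew for [theta], [thetas], so that both systems share the functions [th] and
   [ths]. *)
clear x' y' e' f' Hx' Hy' Ef' a_E' as_E' r' rr'.
have [x' [y' [e' [f' [Hx' Hy' _ a_E' as_E']]]]] := leonard_system_bases hth' hths'.
(* The common [a_0] fixes varphi_1, and the common last dual principal entry fixes varphi_d. *)
have [||s [bij_s sA sAs]] := split_data_determine Hx Hy Hx' Hy' d2 rth.
- rewrite (split_coef0_dual Hx Hy) // (split_coef0_dual Hx' Hy') //.
  by rewrite -a_E -a_E' e_a0.
- rewrite (split_coef_last Hx Hy) // (split_coef_last Hx' Hy') //.
  by rewrite -as_E -as_E' e_asd.
have eig i : ls_A Phi' (e' i) = theta i *: e' i.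
  by rewrite (eigenbasis_eigen Hx') inord_val.
have eigs i : ls_As Phi' (f' i) = thetas i *: f' i.
  by rewrite (eigenbasis_eigen Hy') inord_val.
exists s; split=> // [||i].
- by apply/lfunP => v; rewrite !comp_lfunE.
- by apply/lfunP => v; rewrite !comp_lfunE.
split.
  exact: (idempotent_intertwiner hth hth' (eigenbasis_expand Hx') eig sA).
exact: (idempotent_intertwiner hths hths' (eigenbasis_expand Hy') eigs sAs).
Qed.
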